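(* Let $\mathfrak A$ be a Hausdorff topological Abelian group. If $\mu$ is an $\mathfrak A$-valued measure, then so are $\mathfrak C\mu$, $\mathfrak S\mu$, and $\overline{\mathfrak C}\mu$.
   Context: $D_\mu$, $R_\mu$ denote the domain and range of a map $\mu$; all maps $\mu$ here have as domain a set of sets. $S[\mu]=\bigcup D_\mu$. Countable means finite or countably infinite. A ring (of sets) is a nonempty set of sets closed under union $A\cup B$ and difference $A\setminus B$; a $\delta$-ring is a ring closed under intersections of nonempty countable families. For a set of sets $\mathcal K$, $\hat{\mathcal K}=\{A: A\subset B\text{ for some }B\in\mathcal K\}$. $A\Delta B=(A\setminus B)\cup(B\setminus A)$. A partition of a set $A$ is a family of pairwise disjoint (possibly empty) sets, indexed by a set $I$, whose union is $A$; it is countable if $I$ is countable. A family $f\colon I\to\mathfrak A$ is summable if the net $J\mapsto\sum_{i\in J}f(i)$ over finite subsets $J\subset I$ converges in $\mathfrak A$; the limit is $\sum_{i\in I}f(i)$. An $\mathfrak A$-valued measure is a map $\mu$ such that $D_\mu$ is a $\delta$-ring, $R_\mu\subset\mathfrak A$, and for every $A\in D_\mu$ and every countable partition $\mathbf A\colon I\to D_\mu$ of $A$ the family $\mu\circ\mathbf A$ is summable with $\mu(A)=\sum_{i\in I}\mu(\mathbf A(i))$. For a map $\mu$ with $\varnothing\in D_\mu$, a set $N\in D_\mu$ is $\mu$-null if $\mu(N')=\mu(\varnothing)$ for every $N'\in D_\mu$ with $N'\subset N$; $\mathcal N_\mu$ is the set of all $\mu$-null sets. The map $\mu$ admits completion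 if $D_\mu$ is a ring and $\mu(B_1)=\mu(B_2)$ for all $B_1,B_2\in D_\mu$ with $B_1\Delta B_2\in\mathcal N_\mu$ (every group-valued content, hence every measure, admits completion). If $\mu$ admits completion, a completion ring for $\mu$ is a ring $\mathcal N$ such that $N\cap B\in\mathcal N$ for all $N\in\mathcal N$, $B\in D_\mu$, and $\mathcal N\cap D_\mu=\mathcal N_\mu$. For sets of sets $\mathcal Q,\mathcal N$, $\Delta(\mathcal Q,\mathcal N)=\{A: A\Delta B\in\mathcal N\text{ for some }B\in\mathcal Q\}$. The $\mathcal N$-completion $\mathfrak C_{\mathcal N}\mu$ is the unique (well-defined) map $\nu$ with $D_\nu=\Delta(D_\mu,\mathcal N)$ and $\nu(A)=\mu(B)$ whenever $A\in D_\nu$, $B\in D_\mu$, $A\Delta B\in\mathcal N$. For $\mu$ admitting completion put $\mathcal N_0[\mu]=\{N\subset S[\mu]: N\cap B\in\mathcal N_\mu\text{ for every }B\in D_\mu\}$ and $\mathcal N[\mu]=\{N\subset S[\mu]: N\cap B\in\hat{\mathcal N}_\mu\text{ for every }B\in D_\mu\}$. The sets $\hat{\mathcal N}_\mu$, $\mathcal N_0[\mu]$, $\mathcal N[\mu]$ are completion rings for $\mu$; the corresponding $\mathcal N$-completions of $\mu$ are denoted $\mathfrak C\mu$ (completion), $\mathfrak S\mu$ (saturation) and $\overline{\mathfrak C}\mu$ (essential completion), respectively. *)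

(* Defs.v *)
From HB Require Import structures.
From mathcomp Require Import all_boot all_algebra finmap.
From mathcomp Require Import boolp classical_sets functions cardinality.
From mathcomp Require Import topology normedtype measurable_structure.
From mathcomp.analysis.showcase Require Import summability.

Set Implicit Arguments.
Unset Strict Implicit.
Unset Printing Implicit Defensive.

Import GRing.Theory.

Local Open Scope classical_set_scope.
Local Open Scope ring_scope.

(* A map whose domain is a set of sets.  [setmap_val] is total, but its values
   outside [dom] are junk, on which none of the notions below depends. *)
Record setmap (T V : Type) := SetMap {
  dom : set (set T);
  setmap_val :> set T -> V }.

Section setmaps.
Context {T V : Type}.
Implicit Types (mu : setmap T V) (K N Q : set (set T)) (A B C : set T).

Definition delta_ring (D : set (set T)) :=
  setring D /\
  forall F : set (set T), countable F -> F !=set0 -> F `<=` D ->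
    D (\bigcap_(A in F) A).

Definition hereditary_hull K : set (set T) :=
  [set A | exists2 B, K B & A `<=` B].

Definition carrier mu : set T := \bigcup_(A in dom mu) A.

Definition null_sets mu : set (set T) :=
  [set A | dom mu A /\
           forall B, dom mu B -> B `<=` A -> mu B = mu set0].

Definition admits_completion mu :=
  setring (dom mu) /\
  forall B C, dom mu B -> dom mu C -> null_sets mu (B `+` C) -> mu B = mu C.

Definition completion_ring mu N :=
  [/\ setring N,
      forall A B, N A -> dom mu B -> N (A `&` B) &
      N `&` dom mu = null_sets mu].

Definition Delta Q N : set (set T) := [set A | exists2 B, Q B & N (A `+` B)].

(* On its domain, the value at [A] is [mu B] for a chosen [B] in [dom mu] with
   [A `+` B] in [N]; by [completionE] it does not depend on the choice. *)
Definition completion_along N mu : setmap T V :=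
  SetMap (Delta (dom mu) N)
         (fun A => mu (xget set0 [set B | dom mu B /\ N (A `+` B)])).

Definition local_null_sets mu : set (set T) :=
  [set A | A `<=` carrier mu /\
           forall B, dom mu B -> null_sets mu (A `&` B)].

Definition local_negligible_sets mu : set (set T) :=
  [set A | A `<=` carrier mu /\
           forall B, dom mu B -> hereditary_hull (null_sets mu) (A `&` B)].

Definition completion mu := completion_along (hereditary_hull (null_sets mu)) mu.

Definition saturation mu := completion_along (local_null_sets mu) mu.

Definition essential_completion mu :=
  completion_along (local_negligible_sets mu) mu.

Lemma completionE mu N A B : admits_completion mu -> completion_ring mu N ->
  dom mu B -> N (A `+` B) -> completion_along N mu A = mu B.
Proof.
move=> [[_ DU DD] muE] [[_ NU ND] _ NE] DB NAB /=.
case: xgetP => [C _ [DC NAC]|/(_ B)]; last by case; split.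
apply: muE => //; rewrite -NE; split; last first.
  by rewrite setY_def; apply: DU; exact: DD.
have -> : C `+` B = (A `+` C) `+` (A `+` B).
  by rewrite (setYC A C) -setYA (setYA A A) setYK set0Y.
by rewrite setY_def; apply: NU; exact: ND.
Qed.

Lemma null_setsS mu A B :
  null_sets mu A -> dom mu B -> B `<=` A -> null_sets mu B.
Proof.
move=> [DA A0] DB BA; split=> // C DC CB.
by apply: A0 => //; exact: subset_trans BA.
Qed.

Lemma completion_ring_null_sets mu :
  admits_completion mu -> completion_ring mu (null_sets mu).
Proof.
move=> [[D0 DU DD] muE].
have DI A B : dom mu A -> dom mu B -> dom mu (A `&` B).
  by move=> DA DB; rewrite -setDD; do 2?apply: (DD).
split; first split.
- by split=> // B _; rewrite subset0 => ->.
- move=> A B NA NB; split; first by apply: DU; [case: NA|case: NB].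
  move=> C DC CAB; have [DB B0] := NB.
  have -> : mu C = mu (C `&` B).
    apply: (muE) => //; first exact: DI.
    rewrite setYD; apply: (null_setsS NA); first exact: DD.
    by move=> x [Cx nBx]; have [|/nBx] := CAB _ Cx.
  by apply: B0; [exact: DI|exact: subIsetr].
- move=> A B NA [DB _]; apply: (null_setsS NA); last exact: subDsetl.
  by apply: DD => //; case: NA.
- move=> A B NA DB; apply: (null_setsS NA); last exact: subIsetl.
  by apply: DI => //; case: NA.
- by apply/seteqP; split=> [A []//|A NA]; split=> //; case: NA.
Qed.

Lemma completion_ring_hereditary_hull mu : admits_completion mu ->
  completion_ring mu (hereditary_hull (null_sets mu)).
Proof.
move=> /completion_ring_null_sets [[N0 NU ND] _ _]; split; first split.
- by exists set0.
- move=> A B [A' NA' AA'] [B' NB' BB']; exists (A' `|` B'); first exact: NU.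
  exact: setUSS.
- move=> A B [A' NA' AA'] _; exists A' => //.
  exact: subset_trans (@subDsetl _ _ _) AA'.
- move=> A B [A' NA' AA'] _; exists A' => //.
  exact: subset_trans (@subIsetl _ _ _) AA'.
- apply/seteqP; split=> [A [[B NB BA] DA]|A NA]; first exact: null_setsS BA.
  by split; [exists A|case: NA].
Qed.

Lemma completion_ring_local mu N :
    setring (dom mu) -> completion_ring mu N ->
  completion_ring mu
    [set A | A `<=` carrier mu /\ forall B, dom mu B -> N (A `&` B)].
Proof.
move=> [D0 DU DD] [[N0 NU ND] NI NE]; split; first split.
- by split=> // B _; rewrite set0I.
- move=> A B [SA NA] [SB NB]; split; first by rewrite subUset.
  by move=> C DC; rewrite setIUl; apply: NU; auto.
- move=> A B [SA NA] [SB NB]; split.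
    exact: subset_trans (@subDsetl _ _ _) SA.
  move=> C DC; have -> : (A `\` B) `&` C = (A `&` C) `\` (B `&` C).
    apply/seteqP; split=> x /=; first by move=> [[? ?] ?]; split=> // -[].
    by move=> [[? ?] nBC]; split=> //; split=> // ?; apply: nBC.
  by apply: ND; auto.
- move=> A B [SA NA] DB; split; first exact: subset_trans (@subIsetl _ _ _) SA.
  move=> C DC; rewrite -setIA; apply: NA.
  by rewrite -setDD; do 2?apply: (DD).
- rewrite -NE; apply/seteqP; split=> A [].
    by move=> [_ NA] DA; split=> //; rewrite -(setIid A); exact: NA.
  move=> NA DA; split=> //; split=> [x Ax|B DB]; first by exists A.
  exact: NI.
Qed.

Lemma completion_ring_local_null_sets mu : admits_completion mu ->
  completion_ring mu (local_null_sets mu).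
Proof.
move=> muC; apply: completion_ring_local; first by case: muC.
exact: completion_ring_null_sets.
Qed.

Lemma completion_ring_local_negligible_sets mu : admits_completion mu ->
  completion_ring mu (local_negligible_sets mu).
Proof.
move=> muC; apply: completion_ring_local; first by case: muC.
exact: completion_ring_hereditary_hull.
Qed.

End setmaps.

Definition is_partition {T I : Type} (A : set T) (F : I -> set T) :=
  trivIset [set: I] F /\ \bigcup_i F i = A.

(* Convergence to [s] of the net of sums over the finite subsets of [I]; the
   [choiceType] structure needed for [{fset I}] exists on any index type, by
   classical choice. *)
Definition has_sum {I : choiceType} {V : topologicalZmodType}
    (f : I -> V) (s : V) :=
  partial_sum f @ totally --> s.

Definition group_measure {T : Type} {V : topologicalZmodType}
    (mu : setmap T V) :=
  delta_ring (dom mu) /\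
  forall (A : set T) (I : choiceType) (F : I -> set T),
    countable [set: I] -> dom mu A -> (forall i, dom mu (F i)) ->
    is_partition A F -> has_sum (fun i => mu (F i)) (mu A).

Lemma has_sum_finType (I : finType) (V : topologicalZmodType) (f : I -> V) :
  has_sum f (\sum_i f i).
Proof.
apply: (@cvg_near_cst _ _ _ _ _ (@filter_filter _ _ (totally_filter))).
exists [fset i in I]%fset => // J IJ.
have -> : partial_sum f J = \sum_(i <- J) f i by rewrite big_seq_fsetE.
apply: perm_big.
apply: uniq_perm; rewrite ?fset_uniq ?index_enum_uniq// => i.
by rewrite mem_index_enum; apply: (fsubsetP IJ); rewrite !inE.
Qed.

Lemma group_measure_sum (T : Type) (V : topologicalZmodType)
    (mu : setmap T V) (I : finType) (A : set T) (F : I -> set T) :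
  hausdorff_space V -> group_measure mu ->
  dom mu A -> (forall i, dom mu (F i)) -> is_partition A F ->
  mu A = \sum_i mu (F i).
Proof.
move=> hV [_ muS] DA DF AF.
have FF : ProperFilter (partial_sum (fun i => mu (F i)) @ totally).
  exact: fmap_proper_filter totally_filter.
apply: (cvg_unique hV (F := partial_sum (fun i => mu (F i)) @ totally)).
  by apply: muS => //; apply: finite_set_countable; exact: finite_finset.
exact: has_sum_finType.
Qed.

Lemma group_measure_admits_completion (T : Type) (V : topologicalZmodType)
    (mu : setmap T V) :
  hausdorff_space V -> group_measure mu -> admits_completion mu.
Proof.
move=> hV muM; have [[[D0 DU DD] _] _] := muM.
have mu0 : mu set0 = 0.
  rewrite (@group_measure_sum _ _ _ void set0 (fun=> set0)) ?big_pred0//.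
  by split=> [[]|]; rewrite ?bigcup0.
have muID B C : dom mu B -> dom mu C -> null_sets mu (B `+` C) ->
    mu B = mu (B `&` C).
  move=> DB DC [_ BC0]; have DBC := DD _ _ DB DC.
  rewrite (@group_measure_sum _ _ _ bool B
    (fun b => if b then B `&` C else B `\` C))//.
  - rewrite big_bool /= (BC0 (B `\` C)) ?mu0 ?addr0//.
    by rewrite setY_def; exact: subsetUl.
  - by case=> //; rewrite -setDD; exact: DD.
  - split=> [[] [] _ _ [x []]|]//=; [by move=> [_ ?] []|by move=> [_ ?] []|].
    rewrite -[RHS](setUIDK B C); apply/seteqP; split=> [x [[] _]|x []]/=.
    + by left.
    + by right.
    + by exists true.
    + by exists false.
split=> // B C DB DC BC0.
by rewrite (muID B C)// setIC -(muID C B)// setYC.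
Qed.

(* Main.v *)
Require Import Defs.
From mathcomp Require Import all_boot all_algebra.
From mathcomp Require Import classical_sets topology normedtype.
From mathcomp Require Import boolp cardinality sequences measurable_structure.
From mathcomp.analysis.showcase Require Import summability.

(** Call [A] and [B] equivalent when [A `+` B] lies in a completion ring [N].
    The completion along [N] gives [A] the value of [mu] at any equivalent [B]
    in its domain [D], so it is a measure as soon as every countable situation
    among the sets of [Delta D N] can be copied, up to equivalence, inside [D].

    Finite operations respect equivalence because [N] is a ring that absorbs
    intersections with [D].  Countable ones need more: [N] must contain
    [C `&` \bigcup_n F n] for [F n] in [N] and [C] in [D] or in [N].  The bound
    [C] cannot be dropped, since a union of null sets need not lie in [D].
    Under this condition [A `&` \bigcap_i F i] is equivalent to
    [B `&` \bigcap_i G i] as soon as [A], [B] and the [F i], [G i] are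
    equivalent ([equiv_bigcapI]), which makes [Delta D N] a delta-ring.  For the
    additivity on a partition [F] of [A], take [B], [G i] in [D] equivalent to
    [A], [F i], and delete from each [B `&` G i] the other [G j]: only sets
    equivalent to the empty sets [F i `&` F j] are lost, and the remaining
    disjoint sets have a union equivalent to [A].  The additivity of [mu] on
    them is the required one.

    It remains to see that the three completion rings satisfy the condition.
    Null sets are closed under bounded countable unions because a measurable
    subset of such a union splits into countably many null pieces, and sums are
    unique in a Hausdorff group.  The condition then passes from null sets to
    their hereditary hull, and from any completion ring to its local version. *)

Set Implicit Arguments.
Unset Strict Implicit.
Unset Printing Implicit Defensive.

Local Open Scope classical_set_scope.
Local Open Scope ring_scope.

(* Decides an identity between Boolean combinations of [A], [B], [C], [D]. *)
Ltac set_taut A B C D :=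
  apply/seteqP; split=> z; rewrite ?setY_def /setU /setD /setI /setC /=;
  have [] := pselect (A z); have [] := pselect (B z);
  have [] := pselect (C z); have [] := pselect (D z); tauto.

(** * Rings of sets *)

Lemma setring_setI {T : Type} (K : set (set T)) (A B : set T) :
  setring K -> K A -> K B -> K (A `&` B).
Proof. by move=> [_ _ KD] KA KB; rewrite -setDD; do 2?apply: (KD). Qed.

Lemma setring_setY {T : Type} (K : set (set T)) (A B : set T) :
  setring K -> K A -> K B -> K (A `+` B).
Proof.
by move=> [_ KU KD] KA KB; rewrite setY_def; apply: KU; exact: KD.
Qed.

Lemma setring_bigsetU {T : Type} (K : set (set T)) (F : nat -> set T) n :
  setring K -> (forall k, K (F k)) -> K (\big[setU/set0]_(k < n) F k).
Proof. by move=> [K0 KU _] KF; apply: big_ind. Qed.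

Lemma delta_ring_bigcapI {T I : Type} (D : set (set T)) (P : set I)
    (B : set T) (G : I -> set T) :
  delta_ring D -> countable P -> D B -> (forall i, P i -> D (G i)) ->
  D (B `&` \bigcap_(i in P) G i).
Proof.
move=> [Dring Dcap] cP DB DG.
have [P0|/set0P[i0 Pi0]] := eqVneq P set0.
  by rewrite P0 bigcap_set0 setIT.
have P0 : P !=set0 by exists i0.
rewrite -bigcapIr// -(bigcap_image P (fun i => B `&` G i) id).
apply: Dcap; first exact: sub_countable (card_image_le _ _) cP.
- by exists (B `&` G i0); exists i0.
- by move=> _ [i Pi <-]; apply: setring_setI; auto.
Qed.

Lemma setI_bigcup_bigcap {T I : Type} (P : set I) (B : set T)
    (G : I -> set T) :
  B `&` \bigcup_(i in P) G i = B `\` (B `&` \bigcap_(i in P) (B `\` G i)).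
Proof.
apply/seteqP; split=> x /=.
  by move=> [Bx [i Pi Gix]]; split=> // -[_ /(_ i Pi) []].
move=> [Bx nx]; split=> //; apply: contrapT => nU; apply: nx; split=> // i Pi.
by split=> // Gix; apply: nU; exists i.
Qed.

Lemma delta_ring_bigcupI {T I : Type} (D : set (set T)) (P : set I)
    (B : set T) (G : I -> set T) :
  delta_ring D -> countable P -> D B -> (forall i, P i -> D (G i)) ->
  D (B `&` \bigcup_(i in P) G i).
Proof.
move=> Ddelta cP DB DG; have [[_ _ DD] _] := Ddelta.
rewrite setI_bigcup_bigcap; apply: (DD) => //.
by apply: delta_ring_bigcapI => // i /DG; exact: DD.
Qed.

(** * Bounded countable unions *)

Definition closed_bounded_bigcup {T : Type} (K N : set (set T)) :=
  forall (C : set T) (F : nat -> set T), K C -> (forall n, N (F n)) ->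
    N (C `&` \bigcup_n F n).

(** The [n]-th set of the sequence is the union of the [F i] whose code is [n]:
    at most one such [i] exists, and codes that are not used give the empty
    set, so that an empty index set needs no separate treatment. *)
Lemma countable_bigcup_nat {T I : Type} (N : set (set T)) (P : set I)
    (F : I -> set T) :
  N set0 -> countable P -> (forall i, P i -> N (F i)) ->
  exists2 G : nat -> set T,
    forall n, N (G n) & \bigcup_n G n = \bigcup_(i in P) F i.
Proof.
move=> N0 /countable_injP [f finj] NF.
exists (fun n => \bigcup_(i in [set i | P i /\ f i = n]) F i).
  move=> n; have [[i [Pi fi]]|nI] := pselect (exists i, P i /\ f i = n).
    have -> : [set j | P j /\ f j = n] = [set i].
      apply/seteqP; split=> j /=; last by move=> ->.
      by move=> [Pj fj]; apply: finj; rewrite ?fj ?fi//; exact: mem_set.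
    by rewrite bigcup_set1; exact: NF.
  rewrite (_ : [set _ | _] = set0) ?bigcup_set0//.
  by apply/seteqP; split=> // i Pi; apply: nI; exists i.
apply/seteqP; split=> x; first by move=> [n _ [i [Pi _] Fx]]; exists i.
by move=> [i Pi Fx]; exists (f i) => //; exists i.
Qed.

Lemma closed_bounded_bigcupP {T I : Type} (K N : set (set T)) (P : set I)
    (C : set T) (F : I -> set T) :
  closed_bounded_bigcup K N -> N set0 -> countable P -> K C ->
  (forall i, P i -> N (F i)) -> N (C `&` \bigcup_(i in P) F i).
Proof.
move=> KN N0 cP KC NF; have [G NG <-] := countable_bigcup_nat N0 cP NF.
exact: KN.
Qed.

(** * Equivalence modulo a completion ring *)

Section equivalence.
Context {T : Type} (D N : set (set T)).
Context (Dring : setring D) (Nring : setring N).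
Context (NI : forall A B, N A -> D B -> N (A `&` B)).
Implicit Types A B : set T.

Lemma equiv_setI A A' B B' : D B -> D B' ->
  N (A `+` B) -> N (A' `+` B') -> N ((A `&` A') `+` (B `&` B')).
Proof.
move=> DB DB' NA NA'.
have -> : (A `&` A') `+` (B `&` B') = ((A `+` B) `&` (A' `+` B')) `+`
    (((A `+` B) `&` B') `+` ((A' `+` B') `&` B)) by set_taut A A' B B'.
apply: setring_setY => //; first exact: setring_setI.
by apply: setring_setY => //; exact: NI.
Qed.

Lemma equiv_setY A A' B B' :
  N (A `+` B) -> N (A' `+` B') -> N ((A `+` A') `+` (B `+` B')).
Proof.
move=> NA NA'; have -> : (A `+` A') `+` (B `+` B') =
    (A `+` B) `+` (A' `+` B') by set_taut A A' B B'.
exact: setring_setY.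
Qed.

Lemma equiv_setD A A' B B' : D B -> D B' ->
  N (A `+` B) -> N (A' `+` B') -> N ((A `\` A') `+` (B `\` B')).
Proof.
move=> DB DB' NA NA'.
have DY (X Y : set T) : X `\` Y = X `+` (X `&` Y) by set_taut X Y X Y.
by rewrite !DY; apply: equiv_setY => //; exact: equiv_setI.
Qed.

Lemma equiv_setU A A' B B' : D B -> D B' ->
  N (A `+` B) -> N (A' `+` B') -> N ((A `|` A') `+` (B `|` B')).
Proof.
move=> DB DB' NA NA'.
have UY (X Y : set T) : X `|` Y = (X `+` Y) `+` (X `&` Y) by set_taut X Y X Y.
by rewrite !UY; apply: equiv_setY; [exact: equiv_setY|exact: equiv_setI].
Qed.

Lemma setring_Delta : setring (Delta D N).
Proof.
have [D0 DU DD] := Dring; split.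
- by exists set0 => //; rewrite setYK; case: Nring.
- move=> A A' [B DB NB] [B' DB' NB']; exists (B `|` B'); first exact: DU.
  exact: equiv_setU.
- move=> A A' [B DB NB] [B' DB' NB']; exists (B `\` B'); first exact: DD.
  exact: equiv_setD.
Qed.

Context {I : Type} (P : set I) (cP : countable P).
Context (Nbig : closed_bounded_bigcup (D `|` N) N).
Implicit Types F G : I -> set T.

(** [N] need not contain the subsets of its members, so even this bounded
    intersection relies on [Nbig]: it is the complement in [X] of a countable
    union of members of [N], where the bound [X] is itself in [N]. *)
Lemma completion_ring_bigcapI (X : set T) F :
  N X -> (forall i, P i -> Delta D N (F i)) -> N (X `&` \bigcap_(i in P) F i).
Proof.
move=> NX NF; have [N0 _ ND] := Nring.
have -> : X `&` \bigcap_(i in P) F i =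
    X `\` (X `&` \bigcup_(i in P) (X `\` F i)).
  apply/seteqP; split=> x /=.
    by move=> [Xx Fx]; split=> // -[_ [i Pi [_]]]; apply; exact: Fx.
  move=> [Xx nx]; split=> // i Pi; apply: contrapT => nFx; apply: nx.
  by split=> //; exists i.
apply: (ND) => //; apply: (closed_bounded_bigcupP Nbig) => //; first by right.
move=> i /NF[B DB NFB]; have -> : X `\` F i =
    (X `\` (X `&` B)) `+` (X `&` (F i `+` B)).
  by set_taut X B (F i) B.
apply: setring_setY => //; last exact: setring_setI.
by apply: (ND) => //; exact: NI.
Qed.

(** Replacing [A] by [B] changes the set inside [A `+` B], and then replacing
    the [F i] by the [G i] changes it inside [Y], the part of the union of the
    [F i `+` G i] bounded by [B]; both changes are intersections of a member of
    [N] with countably many members of [Delta D N]. *)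
Lemma equiv_bigcapI A B F G :
  D B -> (forall i, P i -> D (G i)) ->
  N (A `+` B) -> (forall i, P i -> N (F i `+` G i)) ->
  N ((A `&` \bigcap_(i in P) F i) `+` (B `&` \bigcap_(i in P) G i)).
Proof.
move=> DB DG NAB NFG; have [N0 _ _] := Nring.
pose Y := B `&` \bigcup_(i in P) (F i `+` G i).
have NY : N Y by apply: (closed_bounded_bigcupP Nbig) => //; left.
have -> : (A `&` \bigcap_(i in P) F i) `+` (B `&` \bigcap_(i in P) G i) =
    ((A `+` B) `&` \bigcap_(i in P) F i) `+`
    ((Y `&` \bigcap_(i in P) F i) `+` (Y `&` \bigcap_(i in P) G i)).
  have BY : B `&` (\bigcap_(i in P) F i `+` \bigcap_(i in P) G i) `<=` Y.
    move=> x [Bx FGx]; split=> //; apply: contrapT => nx.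
    have FGE i : P i -> F i x <-> G i x.
      move=> Pi; split=> H; apply: contrapT => nH; apply: nx; exists i => //.
        by rewrite setY_def; left.
      by rewrite setY_def; right.
    move: FGx; rewrite setY_def => -[] [capx]; apply=> i Pi; apply/FGE => //;
      exact: capx.
  have YB : Y `<=` B by move=> x [].
  move: BY YB; set U := \bigcap_(i in P) F i; set W := \bigcap_(i in P) G i.
  move=> BY YB; apply/seteqP; split=> z; move: (BY z) (YB z);
    rewrite ?setY_def /setU /setD /setI /setC /=;
    have [] := pselect (A z); have [] := pselect (B z);
    have [] := pselect (U z); have [] := pselect (W z);
    have [] := pselect (Y z); tauto.
apply: setring_setY => //.
  by apply: completion_ring_bigcapI => // i Pi; exists (G i); auto.
apply: setring_setY => //; apply: completion_ring_bigcapI => // i Pi.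
  by exists (G i); auto.
by exists (G i); [exact: DG|rewrite setYK].
Qed.

Lemma equiv_bigcupI A B F G : delta_ring D ->
  D B -> (forall i, P i -> D (G i)) ->
  N (A `+` B) -> (forall i, P i -> N (F i `+` G i)) ->
  N ((A `&` \bigcup_(i in P) F i) `+` (B `&` \bigcup_(i in P) G i)).
Proof.
move=> Ddelta DB DG NAB NFG; have [_ _ DD] := Dring.
have DBG i : P i -> D (B `\` G i) by move=> /DG; exact: DD.
rewrite !setI_bigcup_bigcap; apply: equiv_setD => //.
  exact: delta_ring_bigcapI.
by apply: equiv_bigcapI => // i Pi; apply: equiv_setD; auto.
Qed.

End equivalence.

Lemma delta_ring_Delta {T : Type} (D N : set (set T)) :
  delta_ring D -> setring N -> (forall A B, N A -> D B -> N (A `&` B)) ->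
  closed_bounded_bigcup (D `|` N) N -> delta_ring (Delta D N).
Proof.
move=> Ddelta Nring NI Nbig; have [Dring _] := Ddelta.
split; first exact: setring_Delta.
move=> K cK [A KA] KD.
have /choice[g gP] : forall X, exists B, K X -> D B /\ N (X `+` B).
  move=> X; have [KX|nKX] := pselect (K X); last by exists set0.
  by have [B DB NB] := KD _ KX; exists B.
have Dg X : K X -> D (g X) by move=> /gP[].
have Ng X : K X -> N (X `+` g X) by move=> /gP[].
have -> : \bigcap_(X in K) X = A `&` \bigcap_(X in K) X.
  by apply/esym/setIidPr => x; exact.
exists (g A `&` \bigcap_(X in K) g X).
  by apply: delta_ring_bigcapI => //; exact: Dg.
by apply: (equiv_bigcapI (D := D)); auto.
Qed.

(** Subtracting from [B `&` G i] all the other [G j] at once yields disjoint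
    sets without choosing an order on [I]. *)
Lemma equiv_partition {T I : Type} (D N : set (set T)) (A : set T)
    (F : I -> set T) :
  delta_ring D -> setring N -> (forall A B, N A -> D B -> N (A `&` B)) ->
  closed_bounded_bigcup (D `|` N) N ->
  countable [set: I] -> Delta D N A -> (forall i, Delta D N (F i)) ->
  is_partition A F ->
  exists B (E : I -> set T), [/\ D B, N (A `+` B), forall i, D (E i),
    forall i, N (F i `+` E i) & is_partition B E].
Proof.
move=> Ddelta Nring NI Nbig cI [B DB NAB] DF [Ftriv FA].
have [[D0 DU DD] _] := Ddelta; have [N0 _ _] := Nring.
have Dring : setring D by split.
have /choice[G GP] : forall i, exists B, D B /\ N (F i `+` B).
  by move=> i; have [X DX NX] := DF i; exists X.
have DG i : D (G i) by case: (GP i).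
have NFG i : N (F i `+` G i) by case: (GP i).
pose C (i : I) := [set j | j <> i].
have cC i : countable (C i).
  exact: sub_countable (subset_card_le (@subsetT _ _)) cI.
have FAS i : F i `<=` A by rewrite -FA; exact: bigcup_sup.
pose Z i := (B `&` G i) `&` \bigcup_(j in C i) (G i `&` G j).
have DBG i : D (B `&` G i) by exact: setring_setI.
have DGG i j : D (G i `&` G j) by exact: setring_setI.
have DZ i : D (Z i) by apply: delta_ring_bigcupI.
(* Each [G i `&` G j] is equivalent to [F i `&` F j], which is empty. *)
have NZ i : N (Z i).
  apply: (closed_bounded_bigcupP Nbig) => //; first by left.
  move=> j ji; have FF0 : F i `&` F j = set0.
    apply/seteqP; split=> x // Fx; apply: ji.
    by apply: (Ftriv j i) => //; exists x; rewrite setIC.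
  by rewrite -[X in N X]set0Y -FF0; apply: (equiv_setI (D := D)).
pose E i := (B `&` G i) `\` Z i.
have DE i : D (E i) by exact: DD.
have NFE i : N (F i `+` E i).
  have -> : F i = (A `&` F i) `\` set0.
    by rewrite setD0; apply/esym/setIidPr.
  apply: (equiv_setD (D := D)) => //; last by rewrite set0Y.
  exact: (equiv_setI (D := D)).
exists (B `&` \bigcup_i E i), E; split=> //.
- exact: delta_ring_bigcupI.
- have {1}-> : A = A `&` \bigcup_i F i by rewrite FA setIid.
  exact: (equiv_bigcupI (D := D)).
- split.
    move=> i j _ _ [x [[[Bx Gix] nZ] [[_ Gjx] _]]].
    apply: contrapT => ij; apply: nZ; split=> //.
    by exists j => // ji; apply: ij.
  by apply/esym/setIidPr => x [i _ [[Bx _] _]].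
Qed.

(** * Completion of a measure *)

Lemma group_measure_completion_along {T : Type} {V : topologicalZmodType}
    (mu : setmap T V) (N : set (set T)) :
  group_measure mu -> admits_completion mu -> completion_ring mu N ->
  closed_bounded_bigcup (dom mu `|` N) N ->
  group_measure (completion_along N mu).
Proof.
move=> [Ddelta muS] muC NC Nbig; have [Nring NI _] := NC.
split; first exact: delta_ring_Delta.
move=> A I F cI DA DF AF.
have [B [E [DB NAB DE NFE BE]]] :=
  equiv_partition Ddelta Nring NI Nbig cI DA DF AF.
rewrite (completionE muC NC DB NAB).
rewrite (_ : (fun i => _) = (fun i => mu (E i))); last first.
  by apply/funext => i; exact: completionE.
exact: muS.
Qed.

(** A measurable subset [M] of the union splits into pieces contained in the
    separate [F n]. Both [mu M] and [mu set0] are then sums of the constant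
    sequence [mu set0], hence equal. *)
Lemma null_sets_bounded_bigcup {T : Type} {V : topologicalZmodType}
    (mu : setmap T V) :
  hausdorff_space V -> group_measure mu ->
  closed_bounded_bigcup (dom mu) (null_sets mu).
Proof.
move=> hV [Ddelta muS] C F DC NF; have [Dring _] := Ddelta.
have [D0 _ DD] := Dring.
have DF n : dom mu (F n) by case: (NF n).
split; first exact: delta_ring_bigcupI.
move=> M DM MF.
have DME n : dom mu (M `&` seqDU F n).
  by apply: setring_setI => //; apply: (DD) => //; exact: setring_bigsetU.
have muE n : mu (M `&` seqDU F n) = mu set0.
  by case: (NF n) => _; apply=> // x [_ []].
have sumM : has_sum (fun=> mu set0 : V) (mu M) (I := nat).
  rewrite (_ : (fun=> _) = (fun n => mu (M `&` seqDU F n))); last first.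
    by apply/funext => n; rewrite muE.
  apply: muS => //; first exact: countableP; split.
    move=> i j _ _ [x [[_ Fi] [_ Fj]]].
    by apply: (trivIset_seqDU F) => //; exists x.
  by rewrite -setI_bigcupr -seqDU_bigcup_eq; apply/setIidPl => x /MF[].
have sum0 : has_sum (fun=> mu set0 : V) (mu set0) (I := nat).
  apply: (muS set0 nat (fun=> set0)) => //; first exact: countableP.
  split; last by rewrite bigcup0.
  by move=> i j _ _ [x []].
have FF : ProperFilter (partial_sum (fun _ : nat => mu set0 : V) @ totally).
  exact: fmap_proper_filter totally_filter.
exact: (cvg_unique hV sumM sum0).
Qed.

Lemma hereditary_hull_bounded_bigcup {T : Type} (D N : set (set T)) :
  closed_bounded_bigcup D N -> N set0 ->
  closed_bounded_bigcup (D `|` hereditary_hull N) (hereditary_hull N).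
Proof.
move=> DN N0 C F [DC NF|[B NB CB] _]; last by exists B => // x [/CB].
have /choice[G GP] : forall n, exists B, N B /\ F n `<=` B.
  by move=> n; have [B NB FB] := NF n; exists B.
exists (C `&` \bigcup_n G n); first by apply: DN => // n; case: (GP n).
by move=> x [Cx [n _ Fx]]; split=> //; exists n => //; case: (GP n) => _; exact.
Qed.

(** A bound on the union is supplied by the set of the domain against which
    membership is tested; the intersection with [C] is distributed over the
    union so that [C] may itself be local. *)
Lemma local_bounded_bigcup {T V : Type} (mu : setmap T V) (N : set (set T)) :
  setring (dom mu) -> completion_ring mu N ->
  closed_bounded_bigcup (dom mu) N ->
  let L := [set A | A `<=` carrier mu /\ forall B, dom mu B -> N (A `&` B)] in
  closed_bounded_bigcup (dom mu `|` L) L.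
Proof.
move=> Dring [Nring _ _] DN L C F DLC LF; split.
  by move=> x [_ [n _ Fx]]; case: (LF n) => + _; exact.
move=> B DB.
have -> : (C `&` \bigcup_n F n) `&` B = B `&` \bigcup_n (F n `&` (C `&` B)).
  apply/seteqP; split=> x /=.
    by move=> [[Cx [n _ Fx]] Bx]; split=> //; exists n.
  by move=> [Bx [n _ [Fx [Cx _]]]]; split=> //; split=> //; exists n.
apply: DN => // n; have [_ NF] := LF n; case: DLC => [DC|[_ NCB]].
  by apply: NF; exact: setring_setI.
rewrite (_ : _ `&` _ = (F n `&` B) `&` (C `&` B)).
  by apply: setring_setI; [|exact: NF|exact: NCB].
by rewrite setIACA setIid setIA.
Qed.

Theorem corollary6p10 (T : Type) (V : topologicalZmodType)
    (hV : hausdorff_space V) (mu : setmap T V) :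
  group_measure mu ->
  [/\ group_measure (completion mu), group_measure (saturation mu)
    & group_measure (essential_completion mu)].
Proof.
move=> muM; have muC := group_measure_admits_completion hV muM.
have [Dring _] := muC.
have null_big := null_sets_bounded_bigcup hV muM.
have nullC := completion_ring_null_sets muC.
have hullC := completion_ring_hereditary_hull muC.
have hull_big : closed_bounded_bigcup
    (dom mu `|` hereditary_hull (null_sets mu))
    (hereditary_hull (null_sets mu)).
  by apply: hereditary_hull_bounded_bigcup => //; case: nullC => -[].
split; apply: group_measure_completion_along => //.
- exact: completion_ring_local_null_sets.
- exact: local_bounded_bigcup.
- exact: completion_ring_local_negligible_sets.
- apply: local_bounded_bigcup => //.
  by move=> C F DC; apply: hull_big; left.
Qed.
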